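(* Let $v\in\mathbb{N}$ with $v\ge 2$, let $x\in\mathbb{C}$ with $x-1\notin\mathbb{Z}_0^-$, and let $s\in\mathbb{C}$ with $\mathrm{Re}(s)>v$. Then $$Z(s;x,v)=-\frac{\Gamma(s+v)}{(v-1)!\,\Gamma(s)}\sum_{m_1,\ldots,m_{v-2}=0}^{\infty}\frac{1}{\prod_{j=1}^{v-2}j^{m_j}}\;\Phi\!\left(s+v;\frac{1}{v-1},\,m_1+\cdots+m_{v-2}+x-1\right),$$ where for $v=2$ the sum is understood to consist of the single term $\Phi(s+2;1,x-1)$.
   Context: $\mathbb{Z}_0^-=\{\ldots,-2,-1,0\}$. Complex powers $a^{w}=\exp(w\ln a)$ are taken with the principal branch of the logarithm, $-\pi<\mathrm{Im}(\ln a)\le\pi$. The Lerch zeta function (Lerch transcendent) is $$\Phi(w;z,x)=\sum_{l=0}^{\infty}\frac{z^l}{(l+x)^w},$$ for $x\notin\mathbb{Z}_0^-$, with $w\in\mathbb{C}$ when $|z|<1$ and $\mathrm{Re}(w)>1$ when $|z|=1$. The Hurwitz zeta function is $\zeta(w,u)=\Phi(w;1,u)=\sum_{l=0}^\infty (l+u)^{-w}$. Definition of $Z(s;x,v)$: for an integer $v\ge 3$, $x-1\notin\mathbb{Z}_0^-$ and $\mathrm{Re}(s+v)>1$, $$Z(s;x,v)=-\frac{s(s+1)\cdots(s+v-1)}{(v-1)!}\sum_{m=0}^{\infty}\ \sum_{0\le k_1\le k_2\le\cdots\le k_{v-2}\le m}\frac{1}{\left(\prod_{j=1}^{v-1}j^{\,k_j-k_{j-1}}\right)(x-1+m)^{s+v}},$$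 where $k_0:=0$ and $k_{v-1}:=m$. For $v=2$, $x-1\notin\mathbb{Z}_0^-$ and $\mathrm{Re}(s+2)>1$, $$Z(s;x,2)=-s(s+1)\,\zeta(s+2,x-1).$$ *)

(* Defs.v *)
From mathcomp Require Import all_boot all_order all_algebra.
From mathcomp Require Import all_classical all_reals all_analysis.
From mathcomp Require Import complex summability.

Set Implicit Arguments.
Unset Strict Implicit.
Unset Printing Implicit Defensive.
Import Order.TTheory GRing.Theory Num.Theory.
Import numFieldNormedType.Exports.

Local Open Scope ring_scope.
Local Open Scope complex_scope.

(* R[i] seen as a numFieldType, from which it gets the topology of its norm. *)
Definition Cplx (R : realType) : numFieldType := R[i].

Definition cexp (R : realType) (z : Cplx R) : Cplx R :=
  (expR (complex.Re z))%:C *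
  (cos (complex.Im z) +i* sin (complex.Im z)).

(* Principal argument, in ]-pi, pi] (meaningful for z != 0). *)
Definition carg (R : realType) (z : Cplx R) : R :=
  let t := acos (complex.Re z / ComplexField.Normc.normc z) in
  if 0 <= complex.Im z then t else - t.

Definition clog (R : realType) (z : Cplx R) : Cplx R :=
  ln (ComplexField.Normc.normc z) +i* carg z.

Definition cpow (R : realType) (a w : Cplx R) : Cplx R := cexp (w * clog a).

(* Gauss's form of the Gamma function, valid on all of C minus {0, -1, ...}:
   the limit of n! n^s / (s (s + 1) ... (s + n)). *)
Definition Gamma (R : realType) (s : Cplx R) : Cplx R :=
  limn (fun n : nat =>
    n`!%:R * cpow n%:R s / \prod_(j < n.+1) (s + j%:R) : Cplx R).

Definition nonpos_int (R : realType) (x : Cplx R) : Prop :=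
  exists n : nat, x = - n%:R.

(* Total in w, z, x; intended for x not in {0, -1, ...} and either |z| < 1,
   or |z| = 1 and Re w > 1. *)
Definition Lerch (R : realType) (w z x : Cplx R) : Cplx R :=
  limn (series (fun l : nat => z ^+ l / cpow (l%:R + x) w : Cplx R)).

Definition Hurwitz (R : realType) (w u : Cplx R) : Cplx R := Lerch w 1 u.

(* For k = (k_1, ..., k_(v-2)), chain k j is k_j for 0 <= j <= v - 1, with the
   conventions k_0 = 0 and k_(v-1) = m. *)
Definition chain (p m : nat) (k : p.-tuple 'I_m.+1) (j : nat) : nat :=
  nth 0%N (0%N :: rcons (map val k) m) j.

(* The sum over 0 <= k_1 <= ... <= k_(v-2) <= m in Z; the ordinal bound on the
   entries of k gives k_(v-2) <= m, so the exponents never truncate. *)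
Definition Zinner (R : realType) (v m : nat) (b w : Cplx R) : Cplx R :=
  \sum_(k : (v - 2).-tuple 'I_m.+1 | sorted leq (map val k))
    (\prod_(1 <= j < v) j%:R ^+ (chain k j - chain k j.-1)
     * cpow (b + m%:R) w)^-1.

(* Intended for v >= 2, x - 1 not in {0, -1, ...} and Re (s + v) > 1. *)
Definition Z (R : realType) (s x : Cplx R) (v : nat) : Cplx R :=
  if v == 2%N then - (s * (s + 1)) * Hurwitz (s + 2%:R) (x - 1)
  else - (\prod_(j < v) (s + j%:R) / (v.-1)`!%:R)
       * limn (series (fun m : nat => Zinner v m (x - 1) (s + v%:R))).

(* General term of the multiple series, at m = (m_1, ..., m_(v-2)); the entry of
   index j of the tuple is m_(j+1). *)
Definition Lerch_term (R : realType) (s x : Cplx R) (v : nat)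
    (m : (v - 2).-tuple nat) : Cplx R :=
  (\prod_(j < v - 2) (j.+1)%:R ^+ tnth m j)^-1
  * Lerch (s + v%:R) (1 / (v%:R - 1))
      ((\sum_(j < v - 2) tnth m j)%N%:R + x - 1).

(* Main.v *)
(* Writing m_j = k_j - k_(j-1), the pairs (m, k) of the double sum defining Z are
   exactly the tuples (m_1, ..., m_(v-1)) of naturals, with m their sum.  Both
   sides are therefore rearrangements of the single family
     prod_j j^(-m_j) (x - 1 + m_1 + ... + m_(v-1))^(-s-v),
   grouped by the value of m on the left and by (m_1, ..., m_(v-2)) on the right.
   The family is absolutely summable: |x - 1 + m| >= d (m + 1) for some d > 0, so
   the power decays like (m + 1)^(-2) <= (m_1 + 1)^(-2), which makes up for the
   missing geometric decay in m_1.
   The Gamma quotient is s (s + 1) ... (s + v - 1) by the functional equation,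
   provided that Gauss's product converges to a nonzero limit; its consecutive
   ratios are 1 + O(1/n^2). *)

Require Import Defs.
From mathcomp Require Import all_boot all_order all_algebra.
From mathcomp Require Import all_classical all_reals all_analysis.
From mathcomp Require Import complex summability finmap ring lra.

Import Order.TTheory GRing.Theory Num.Theory.
Import numFieldNormedType.Exports.
Local Open Scope classical_set_scope.
Local Open Scope ring_scope.

#[local] Existing Instance totally_filter.

(** * Unconditional summation *)

(** The limit runs over the finite subsets of [T] directed by inclusion, so no enumeration of [T] is
    chosen and one sum can be grouped in several ways. *)
Definition has_sum {T : choiceType} {K : numFieldType} {V : normedModType K}
    (f : T -> V) (l : V) : Prop :=
  partial_sum f @ totally --> l.

Section has_sum_theory.
Context {T : choiceType} {K : numFieldType} {V : normedModType K}.
Implicit Types (f : T -> V) (l : V).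

Lemma partial_sumE {W : zmodType} (f : T -> W) (A : {fset T}) :
  partial_sum f A = \sum_(t <- A) f t.
Proof. by rewrite /partial_sum big_seq_fsetE. Qed.

Lemma has_sumP {f l} : has_sum f l <-> forall e : K, 0 < e ->
  exists A : {fset T}, forall B : {fset T}, (A `<=` B)%fset ->
    `|l - \sum_(t <- B) f t| <= e.
Proof.
rewrite /has_sum; split => [/cvgrPdist_le fl e e0|fl].
  have [A _ AB] := fl e e0; by exists A => B /AB /=; rewrite partial_sumE.
apply/cvgrPdist_le => e /fl[A AB]; exists A => // B /AB.
by rewrite /= partial_sumE.
Qed.

Lemma eq_has_sum {f g l} : f =1 g -> has_sum f l -> has_sum g l.
Proof. by move=> /funext ->. Qed.

Lemma has_sumD {f g l m} :
  has_sum f l -> has_sum g m -> has_sum (fun t => f t + g t) (l + m).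
Proof.
rewrite /has_sum => fl gm.
rewrite (_ : partial_sum _ = partial_sum f + partial_sum g); first exact: cvgD.
by apply/funext => A; rewrite fctE !partial_sumE big_split.
Qed.

Lemma has_sumZ {f l} a : has_sum f l -> has_sum (fun t => a *: f t) (a *: l).
Proof.
rewrite /has_sum => fl.
rewrite (_ : partial_sum _ = (fun A => a *: partial_sum f A)).
  exact: cvgZr.
by apply/funext => A; rewrite !partial_sumE scaler_sumr.
Qed.

(** The support lies in the finite image of [d], so every partial sum over a set containing that
    image already equals the total. *)
Lemma has_sum_image {I : finType} (P : pred I) (d : I -> T) f :
  {in P &, injective d} ->
  (forall t, f t != 0 -> exists2 i, P i & t = d i) ->
  has_sum f (\sum_(i | P i) f (d i)).
Proof.
move=> dI fd; apply/has_sumP => e e0.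
pose A := [fset d i | i in P]%fset.
have sA : \sum_(t <- A) f t = \sum_(i | P i) f (d i).
  by rewrite big_imfset //= big_enum.
exists A => B AB; rewrite -sA (big_fset_incl _ AB) ?subrr ?normr0 ?ltW//= => t _ tA.
apply/eqP; apply: contraNT tA => /fd[i Pi ->].
by apply/imfsetP; exists i.
Qed.

End has_sum_theory.

(** Regrouping along the fibres of [g]. For a large finite [W] in [U], a finite set of indices lying
    over [W] can be chosen whose sum is close both to [l] and to the sum of [F] over [W]. *)
Lemma has_sum_fibre {T U : choiceType} {K : numFieldType} {V : normedModType K}
    (g : T -> U) {f : T -> V} {l : V} {F : U -> V} :
  has_sum f l ->
  (forall u, has_sum (fun t => if g t == u then f t else 0) (F u)) ->
  has_sum F l.
Proof.
move=> /has_sumP fl fF; apply/has_sumP => e e0.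
have e20 : 0 < e / 2 by rewrite divr_gt0.
have [A0 A0P] := fl _ e20; exists [fset g t | t in A0]%fset => W AW.
(* The error e / 2 is shared among the elements of [W]; the successor keeps the divisor positive
   when [W] is empty. *)
pose N : K := (size W).+1%:R.
have N0 : 0 < N by rewrite ltr0Sn.
have /choice[A AP] : forall u, exists A : {fset T}, forall B : {fset T},
    (A `<=` B)%fset ->
    `|F u - \sum_(t <- B) (if g t == u then f t else 0)| <= e / 2 / N.
  by move=> u; apply: has_sumP.1; rewrite ?divr_gt0.
(* [B] is large enough for every fibre over [W] at once. Its part [B'] over [W] still contains [A0],
   because [W] contains the image of [A0]. *)
pose B := (A0 `|` \bigcup_(u <- W) A u)%fset.
pose B' := [fset t in B | g t \in W]%fset.
have BB' : \sum_(t <- B') f t =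
    \sum_(u <- W) \sum_(t <- B) (if g t == u then f t else 0).
  rewrite exchange_big /= big_fset /= big_mkcond /=.
  apply: eq_bigr => t _; case: ifPn => gtW.
    rewrite (big_fsetD1 (g t)) //= eqxx big1_fset ?addr0// => u.
    by rewrite !inE => /andP[/negbTE ug _] _; rewrite eq_sym ug.
  rewrite big1_fset // => u uW _; case: eqP => // gu.
  by rewrite gu uW in gtW.
have A0B' : (A0 `<=` B')%fset.
  apply/fsubsetP => t tA; rewrite !inE tA /=.
  by apply: (fsubsetP AW); apply/imfsetP; exists t.
have := A0P _ A0B'; rewrite BB' => lB.
rewrite (splitr e) -(subrKA (\sum_(u <- W)
  \sum_(t <- B) (if g t == u then f t else 0)) l).
apply: (le_trans (ler_normD _ _)); rewrite lerD//.
rewrite -sumrB; apply: (le_trans (ler_norm_sum _ _ _)).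
apply: (@le_trans _ _ (\sum_(u <- W) e / 2 / N)).
  rewrite big_seq [leRHS]big_seq; apply: ler_sum => u uW.
  rewrite distrC; apply: AP; apply: fsubset_trans (fsubsetUr _ _).
  exact: bigfcup_sup.
rewrite big_const_seq count_predT iter_addr_0 -[_ *+ _]mulr_natr.
rewrite mulrAC ler_pdivrMr//.
by rewrite ler_wpM2l ?(ltW e20)// ler_nat.
Qed.

Lemma ler_sum_fset {T : choiceType} {K : numDomainType} (f : T -> K)
    {A B : {fset T}} :
  (forall t, 0 <= f t) -> (A `<=` B)%fset ->
  \sum_(t <- A) f t <= \sum_(t <- B) f t.
Proof.
move=> f0 /fsubsetP AB; rewrite (big_fsetID _ (mem A) B) /=.
rewrite (_ : [fset x in B | x \in A]%fset = A) ?lerDl ?sumr_ge0//.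
by apply/fsetP => t; rewrite !inE /= andb_idl// => /AB.
Qed.

Lemma sum_fset_iota {W : nmodType} (f : nat -> W) n :
  \sum_(i <- [fset i in index_iota 0 n]%fset) f i = \sum_(0 <= i < n) f i.
Proof.
apply: perm_big; apply: uniq_perm; rewrite ?iota_uniq ?fset_uniq // => i.
by rewrite !inE.
Qed.

Lemma fsubset_iota {A : {fset nat}} {n : nat} : (\max_(j <- A) j < n)%N ->
  (A `<=` [fset i in index_iota 0 n])%fset.
Proof.
move=> An; apply/fsubsetP => i iA; rewrite !inE mem_index_iota /=.
by apply: leq_trans An; rewrite ltnS leq_bigmax_seq.
Qed.

(** Initial segments of the naturals are cofinal among the finite subsets. *)
Lemma has_sum_series {K : numFieldType} {V : normedModType K}
  {f : nat -> V} {l : V} : has_sum f l -> series f @ \oo --> l.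
Proof.
move=> /has_sumP fl; apply/cvgrPdist_le => e /fl[A AP].
near=> n; rewrite seriesEnat /= -sum_fset_iota; apply: AP.
by apply: fsubset_iota; near: n; exact: nbhs_infty_ge.
Unshelve. all: by end_near. Qed.

(** * The modulus with values in the reals *)

Notation cnorm := ComplexField.Normc.normc.

Section complex_norm.
Context {R : realType}.
Implicit Types z w : Cplx R.

Lemma cnormE z : `|z| = (cnorm z)%:C%C :> Cplx R.
Proof. by []. Qed.

Lemma cnorm_ge0 z : 0 <= cnorm z.
Proof. by case: z => a b; exact: sqrtr_ge0. Qed.

Lemma cnorm_eq0 z : (cnorm z == 0) = (z == 0).
Proof.
apply/eqP/eqP => [/ComplexField.Normc.eq0_normc//|->].
exact: ComplexField.Normc.normc0.
Qed.

Lemma cnorm_gt0 z : (0 < cnorm z) = (z != 0).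
Proof. by rewrite lt_neqAle cnorm_ge0 andbT eq_sym cnorm_eq0. Qed.

Lemma cnormM z w : cnorm (z * w) = cnorm z * cnorm w.
Proof. exact: ComplexField.Normc.normcM. Qed.

Lemma cnormV z : cnorm z^-1 = (cnorm z)^-1.
Proof. exact: ComplexField.Normc.normcV. Qed.

Lemma cnormD z w : cnorm (z + w) <= cnorm z + cnorm w.
Proof. exact: le_normcD. Qed.

Lemma cnormN z : cnorm (- z) = cnorm z.
Proof. exact: normcN. Qed.

Lemma cnorm_real (a : R) : cnorm (a%:C%C : Cplx R) = `|a|.
Proof. by rewrite /= expr0n addr0 sqrtr_sqr. Qed.

Lemma cnorm_nat n : cnorm (n%:R : Cplx R) = n%:R.
Proof.
by rewrite -[n%:R in LHS](rmorph_nat (real_complex R)) cnorm_real normr_nat.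
Qed.

Lemma cnorm_Re z : `|complex.Re z| <= cnorm z.
Proof. by rewrite -lecR; exact: normc_ge_Re. Qed.

Lemma cnorm_Im z : `|complex.Im z| <= cnorm z.
Proof. by case: z => a b; rewrite /= -sqrtr_sqr ler_wsqrtr// lerDr sqr_ge0. Qed.

Lemma cnorm_le_ReIm (a b : R) : cnorm ((a +i* b)%C : Cplx R) <= `|a| + `|b|.
Proof.
rewrite /= -[leRHS]ger0_norm ?addr_ge0// -sqrtr_sqr ler_wsqrtr//.
by rewrite sqrrD !real_normK ?num_real// lerD2r lerDl mulrn_wge0 ?mulr_ge0.
Qed.

Lemma cnorm_prod (I : Type) (r : seq I) (P : pred I) (F : I -> Cplx R) :
  cnorm (\prod_(i <- r | P i) F i) = \prod_(i <- r | P i) cnorm (F i).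
Proof.
elim/big_rec2: _ => [|i x y _ <-]; first exact: ComplexField.Normc.normc1.
by rewrite cnormM.
Qed.

Lemma cnormX z n : cnorm (z ^+ n) = cnorm z ^+ n.
Proof.
by elim: n => [|n IH]; [exact: ComplexField.Normc.normc1|rewrite !exprS cnormM IH].
Qed.

(** Comparable elements of [R[i]] have equal imaginary parts, so a positive one is real. This
    reduces complex epsilons to real ones. *)
Lemma Cplx_gt0P (e : Cplx R) : 0 < e -> exists2 r : R, 0 < r & e = r%:C%C.
Proof. by case: e => a b; rewrite ltcE /= => /andP[/eqP-> a0]; exists a. Qed.

End complex_norm.

(** * Absolute summability implies summability *)

Section absolutely_summable.
Context {R : realType} {T : choiceType}.

(** For nonnegative terms the sum is the supremum of the finite partial sums. *)
Lemma has_sum_ge0 (f : T -> R) M : (forall t, 0 <= f t) ->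
  (forall A : {fset T}, \sum_(t <- A) f t <= M) -> exists l, has_sum f l.
Proof.
move=> f0 fM.
pose S : set R := [set x | exists A : {fset T}, x = \sum_(t <- A) f t].
have hS : has_sup S.
  split; first by exists (\sum_(t <- fset0) f t), fset0.
  by exists M => _ [A ->].
exists (sup S); apply/has_sumP => e e0.
have [_ [A ->] eA] := sup_adherent e0 hS.
exists A => B AB.
have BS : \sum_(t <- B) f t <= sup S by apply: sup_upper_bound => //; exists B.
rewrite ger0_norm ?subr_ge0// lerBlDr -lerBlDl (le_trans (ltW eA))//.
exact: ler_sum_fset.
Qed.

Lemma has_sum_real_complex {f : T -> R} {l} : has_sum f l ->
  has_sum (fun t => (f t)%:C%C : Cplx R) (l%:C%C : Cplx R).
Proof.
move=> /has_sumP fl; apply/has_sumP => _ /Cplx_gt0P[e e0 ->].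
have [A AP] := fl _ e0; exists A => B /AP.
by rewrite -rmorph_sum -rmorphB cnormE cnorm_real lecR.
Qed.

(** Real and imaginary parts are each split into positive and negative parts, all four dominated by
    the modulus. [part] treats nonnegative families and [part2] signed ones. *)
Lemma has_sum_abs (f : T -> Cplx R) (M : R) :
  (forall A : {fset T}, \sum_(t <- A) cnorm (f t) <= M) ->
  exists l, has_sum f l.
Proof.
move=> fM.
have part (p : T -> R) : (forall t, 0 <= p t <= cnorm (f t)) ->
    exists l, has_sum (fun t => (p t)%:C%C : Cplx R) l.
  move=> pf; have [t|A|l pl] := @has_sum_ge0 p M.
  - by have /andP[] := pf t.
  - by apply: le_trans (fM A); apply: ler_sum => t _; have /andP[] := pf t.
  - by exists (l%:C%C); exact: has_sum_real_complex.
have part2 (p : T -> R) : (forall t, `|p t| <= cnorm (f t)) ->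
    exists l, has_sum (fun t => (p t)%:C%C : Cplx R) l.
  move=> pf.
  have [t|l1 h1] := part (fun t => Num.max (p t) 0).
    rewrite le_max lexx orbT ge_max (cnorm_ge0 (f t)) andbT /=.
    exact: le_trans (ler_norm _) (pf t).
  have [t|l2 h2] := part (fun t => Num.max (- p t) 0).
    rewrite le_max lexx orbT ge_max (cnorm_ge0 (f t)) andbT /=.
    by apply: le_trans (pf t); rewrite -normrN ler_norm.
  eexists.
  apply: (eq_has_sum _ (has_sumD h1 (has_sumZ (-1 : Cplx R) h2))) => t.
  rewrite scaleN1r -rmorphB; congr (_%:C%C).
  have [p0|/ltW p0] := leP (p t) 0.
    by rewrite max_l ?oppr_ge0// sub0r opprK.
  by rewrite max_r ?oppr_le0// subr0.
have [t|l1 h1] := part2 (fun t => complex.Re (f t)); first exact: cnorm_Re.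
have [t|l2 h2] := part2 (fun t => complex.Im (f t)); first exact: cnorm_Im.
eexists.
apply: (eq_has_sum _ (has_sumD h1 (has_sumZ ('i%C : Cplx R) h2))) => t.
by rewrite [RHS]complexE.
Qed.

End absolutely_summable.

(** * The complex exponential *)

Section cexp_theory.
Context {R : realType}.
Implicit Types (a b : R) (z w : Cplx R).

Lemma cexpD z w : cexp (z + w) = cexp z * cexp w.
Proof.
case: z w => [a b] [c d]; rewrite /cexp /= expRD cosD sinD.
by apply/eqP; rewrite eq_complex /=; apply/andP; split; apply/eqP; ring.
Qed.

Lemma cnorm_cexp z : cnorm (cexp z) = expR (complex.Re z).
Proof.
rewrite /cexp cnormM cnorm_real ger0_norm ?expR_ge0//=.
by rewrite cos2Dsin2 sqrtr1 mulr1.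
Qed.

Lemma cexp_neq0 z : cexp z != 0.
Proof. by rewrite -cnorm_gt0 cnorm_cexp expR_gt0. Qed.

Lemma cexp_real a : cexp (a%:C%C : Cplx R) = (expR a)%:C%C.
Proof. by rewrite /cexp /= cos0 sin0 mulr1. Qed.

Lemma clog_nat n : (0 < n)%N -> clog (n%:R : Cplx R) = (ln n%:R)%:C%C.
Proof.
move=> n0; rewrite /clog cnorm_nat /carg cnorm_nat.
rewrite -(rmorph_nat (real_complex R)) /= lexx divff ?acos1//.
by rewrite pnatr_eq0 -lt0n.
Qed.

Lemma abs_expRB1 a : `|expR a - 1| <= `|a| * expR `|a|.
Proof.
have e1 := expR_ge1Dx (- a); have e2 := expR_ge1Dx a.
have eN : expR (- a) * expR a = 1 by rewrite -expRD addNr expR0.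
have p := expR_gt0 a.
have [a0|a0] := leP 0 a.
  by rewrite ger0_norm ?subr_ge0 -?expR0 ?ler_expR// ger0_norm// expR0; nra.
rewrite (ltr0_norm a0) ler0_norm ?subr_le0 -?expR0 ?ler_expR ?ltW//.
have : 1 <= expR (- a) by rewrite -expR0 ler_expR oppr_ge0 ltW.
by rewrite expR0; nra.
Qed.

Lemma abs_expRB1x a : `|expR a - 1 - a| <= a ^+ 2 * expR `|a|.
Proof.
have e1 := expR_ge1Dx (- a); have e2 := expR_ge1Dx a.
have eN : expR (- a) * expR a = 1 by rewrite -expRD addNr expR0.
have p := expR_gt0 a.
rewrite ger0_norm; last by rewrite -addrA -opprD subr_ge0.
(* This is 1 - a <= exp (- a) multiplied by exp a. *)
apply: (@le_trans _ _ (a * (expR a - 1))); first by nra.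
rewrite (le_trans (ler_norm _))// normrM -(@real_normK _ a) ?num_real//.
by rewrite expr2 -mulrA ler_wpM2l// abs_expRB1.
Qed.

Lemma abs_sin_le b : `|sin b| <= `|b|.
Proof.
wlog b0 : b / 0 <= b => [h|].
  have [/h//|/ltW b0] := leP 0 b.
  by have := h (- b); rewrite oppr_ge0 sinN !normrN; exact.
have [c _] := @MVT_segment R sin cos 0 b b0 (fun x _ => is_derive_sin x)
  (continuous_subspaceT (@continuous_sin R)).
rewrite sin0 !subr0 => ->; rewrite normrM ler_piMl//.
by rewrite ler_norml cos_geN1 cos_le1.
Qed.

Lemma cosB1E b : cos b - 1 = - (sin (b / 2) ^+ 2 *+ 2).
Proof.
have /(congr1 cos) := splitr b; rewrite cosD -!expr2 cos2sin2 => ->.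
by rewrite mulr2n; ring.
Qed.

Lemma abs_cosB1_le b : `|cos b - 1| <= b ^+ 2.
Proof.
rewrite cosB1E normrN normrMn normrX.
have := abs_sin_le (b / 2); rewrite normrM (@ger0_norm _ 2^-1)//.
have := normr_ge0 (sin (b / 2)); rewrite -(@real_normK _ b) ?num_real//.
by have := normr_ge0 b; nra.
Qed.

(** Mean value theorem for sin x - x, whose derivative cos x - 1 is at most quadratic. *)
Lemma abs_sinBx_le b : `|sin b - b| <= `|b| ^+ 2 * `|b|.
Proof.
wlog b0 : b / 0 <= b => [h|].
  have [/h//|/ltW b0] := leP 0 b.
  have := h (- b); rewrite oppr_ge0 sinN -opprD !normrN; exact.
have d (x : R) : x \in `]0, b[ -> is_derive x 1 (fun x => sin x - x) (cos x - 1).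
  by move=> _; apply: is_deriveB.
have cf : {within `[0, b], continuous (fun x => sin x - x)}.
  apply: continuous_subspaceT => x; apply: cvgB; last exact: cvg_id.
  exact: continuous_sin.
have [c] := @MVT_segment R (fun x => sin x - x) (fun x => cos x - 1) 0 b b0 d cf.
rewrite in_itv /= => /andP[c0 cb].
rewrite sin0 !subr0 => ->; rewrite normrM ler_wpM2r//.
rewrite (le_trans (abs_cosB1_le c))// ger0_norm//.
by rewrite ler_pXn2r// nnegrE.
Qed.

(** The real and imaginary parts of the remainder are combinations of one-variable remainders of
    exp, cos and sin, each quadratic in the modulus of [z]. *)
Lemma cexp_taylor1 (rho : R) : exists2 M : R, 0 <= M &
  forall z, cnorm z <= rho -> cnorm (cexp z - 1 - z) <= M * cnorm z ^+ 2.
Proof.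
(* Of the four summands bounded below, [h1], [h2] and [h4] contribute the 3, while the cubic
   remainder of sin in [h3] contributes the absolute value of [rho]. *)
exists (expR rho * (3 + `|rho|)) => [|[a b]]; first by rewrite mulr_ge0 ?expR_ge0 ?addr_ge0.
set n := cnorm _ => zr.
have an : `|a| <= n := cnorm_Re (a +i* b)%C.
have bn : `|b| <= n := cnorm_Im (a +i* b)%C.
have n0 : 0 <= n := cnorm_ge0 (a +i* b)%C.
have E : cexp ((a +i* b)%C : Cplx R) - 1 - (a +i* b)%C =
    ((expR a - 1 - a + expR a * (cos b - 1)) +i*
     (expR a * (sin b - b) + (expR a - 1) * b))%C.
  rewrite /cexp /=; by apply/eqP; rewrite eq_complex /=; apply/andP; split; apply/eqP; ring.
rewrite E (le_trans (cnorm_le_ReIm _ _))//.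
have ea : expR a <= expR rho.
  by rewrite ler_expR (le_trans (ler_norm a))// (le_trans an).
have eaa : expR `|a| <= expR rho by rewrite ler_expR (le_trans an).
have e0 := expR_gt0 rho.
have h1 : `|expR a - 1 - a| <= expR rho * n ^+ 2.
  rewrite (le_trans (abs_expRB1x a))// mulrC ler_pM ?expR_ge0 ?sqr_ge0//.
  by rewrite -(@real_normK _ a) ?num_real// ler_pXn2r// nnegrE.
have h2 : `|expR a * (cos b - 1)| <= expR rho * n ^+ 2.
  rewrite normrM ger0_norm ?expR_ge0// ler_pM ?expR_ge0//.
  rewrite (le_trans (abs_cosB1_le b))// -(@real_normK _ b) ?num_real//.
  by rewrite ler_pXn2r// nnegrE.
have h3 : `|expR a * (sin b - b)| <= expR rho * (n ^+ 2 * `|rho|).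
  rewrite normrM ger0_norm ?expR_ge0// ler_pM ?expR_ge0//.
  rewrite (le_trans (abs_sinBx_le b))// ler_pM ?ler_pXn2r ?nnegrE ?exprn_ge0//.
  by rewrite (le_trans bn)// (le_trans zr)// ler_norm.
have h4 : `|(expR a - 1) * b| <= expR rho * n ^+ 2.
  rewrite normrM expr2 mulrA ler_pM// (le_trans (abs_expRB1 a))// mulrC.
  by rewrite ler_pM ?expR_ge0.
have := ler_normD (expR a - 1 - a) (expR a * (cos b - 1)).
have := ler_normD (expR a * (sin b - b)) ((expR a - 1) * b).
by lra.
Qed.

End cexp_theory.

(** * Infinite products and the Gamma function *)

(** The minimum of [c] and the first [N] terms is a lower bound; the induction absorbs these terms
    one by one. *)
Lemma lower_bound_pos {R : realType} {x : nat -> R} (N : nat) {c : R} :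
  (forall n, 0 < x n) -> 0 < c -> (forall n, (N <= n)%N -> c <= x n) ->
  exists2 d : R, 0 < d & forall n, d <= x n.
Proof.
move=> x0; elim: N c => [|N IH] c c0 xc; first by exists c => // n; exact: xc.
apply: (IH (Num.min c (x N))); first by rewrite lt_min c0 x0.
move=> n; rewrite leq_eqVlt => /predU1P[<-|/xc cx]; first by rewrite ge_min lexx orbT.
by rewrite ge_min cx.
Qed.

Lemma sum_fset_nat_le {R : realDomainType} (h : nat -> R) {M : R} :
  (forall n, 0 <= h n) -> (forall n, \sum_(i < n) h i <= M) ->
  forall A : {fset nat}, \sum_(i <- A) h i <= M.
Proof.
move=> h0 hM A; apply: le_trans (hM (\max_(j <- A) j).+1).
rewrite -(big_mkord xpredT h) -sum_fset_iota.
by apply: ler_sum_fset => //; exact: fsubset_iota.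
Qed.

Lemma sum_inv_sqr_le {R : realFieldType} n :
  \sum_(i < n) (i.+1%:R ^- 2 : R) <= 2.
Proof.
case: n => [|n]; first by rewrite big_ord0.
(* The bound is sharpened so that it follows by induction, from (x + 1)^-2 <= 1/x - 1/(x + 1). *)
suff : \sum_(i < n.+1) (i.+1%:R ^- 2 : R) <= 2 - n.+1%:R^-1.
  by move=> /le_trans; apply; rewrite gerBl invr_ge0.
have telescope (x : R) : 0 < x -> (x + 1) ^- 2 <= x^-1 - (x + 1)^-1.
  move=> x0; have x10 : 0 < x + 1 by rewrite addr_gt0.
  rewrite -subr_ge0 (_ : _ - _ = x^-1 * (x + 1) ^- 2).
    by rewrite mulr_ge0 ?invr_ge0 ?exprn_ge0 ?ltW.
  by field; rewrite !gt_eqF.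
elim: n => [|n IH]; first by rewrite big_ord1 expr1n invr1; lra.
rewrite big_ord_recr /= (le_trans (lerD IH (lexx _)))//.
have := telescope n.+1%:R (ltr0Sn _ _); rewrite natr1.
by move: (n.+2%:R ^- 2) (n.+1%:R^-1) (n.+2%:R^-1) => x y z; lra.
Qed.

Section infinite_product.
Context {R : realType}.
Implicit Types a u : nat -> Cplx R.

(** The differences are absolutely summable, and their partial sums telescope to a n - a 0. *)
Lemma cvg_bounded_variation {a} (h : nat -> R) (M : R) :
  (forall n, cnorm (a n.+1 - a n) <= h n) -> (forall n, \sum_(i < n) h i <= M) ->
  exists l : Cplx R, a @ \oo --> l.
Proof.
move=> ah hM; have [A|l al] := @has_sum_abs _ nat (fun n => a n.+1 - a n) M.
  have h0 n : 0 <= h n := le_trans (cnorm_ge0 _) (ah n).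
  apply: le_trans (sum_fset_nat_le h h0 hM A).
  by apply: ler_sum => n _; exact: ah.
exists (l + a 0%N).
have /cvgrPdist_le sl := has_sum_series al.
apply/cvgrPdist_le => e /sl; apply: filterS => n.
by rewrite seriesEnat /= telescope_sumr// opprB addrA.
Qed.

(** From 1 + t <= exp t the partial products are bounded, so the increments a n * u n are O(1/n^2)
    and the variation is finite. *)
Lemma cvg_infinite_product {a u} {C : R} :
  (forall n, a n.+1 = a n * (1 + u n)) ->
  (forall n, cnorm (u n) <= C * n.+1%:R ^- 2) ->
  exists l : Cplx R, a @ \oo --> l.
Proof.
move=> au uC.
have C0 : 0 <= C by have := le_trans (cnorm_ge0 _) (uC 0%N); rewrite expr1n invr1 mulr1.
have aB n : cnorm (a n) <= cnorm (a 0%N) * expR (C * \sum_(i < n) i.+1%:R ^- 2).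
  elim: n => [|n IH]; first by rewrite big_ord0 mulr0 expR0 mulr1.
  rewrite au cnormM big_ord_recr mulrDr expRD mulrA.
  rewrite ler_pM ?cnorm_ge0// (le_trans (cnormD _ _))//.
  rewrite (le_trans _ (expR_ge1Dx _))// lerD// ?uC//.
  by rewrite ComplexField.Normc.normc1.
pose B := cnorm (a 0%N) * expR (C * 2).
have {}aB n : cnorm (a n) <= B.
  by rewrite (le_trans (aB n))// ler_wpM2l ?cnorm_ge0// ler_expR ler_wpM2l// sum_inv_sqr_le.
apply: (@cvg_bounded_variation a (fun n => B * C * n.+1%:R ^- 2) (B * C * 2)) => n.
  rewrite au mulrDr mulr1 addrAC subrr add0r cnormM -mulrA.
  by rewrite ler_pM ?cnorm_ge0.
rewrite -mulr_sumr ler_wpM2l ?sum_inv_sqr_le// mulr_ge0//.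
exact: le_trans (cnorm_ge0 _) (aB 0%N).
Qed.

(** The reciprocals form a product of the same kind, with factors 1 - u / (1 + u), so they converge
    too. The two limits multiply to 1. *)
Lemma cvg_infinite_product_neq0 {a u} {C : R} :
  a 0%N != 0 -> (forall n, a n.+1 = a n * (1 + u n)) ->
  (forall n, 1 + u n != 0) ->
  (forall n, cnorm (u n) <= C * n.+1%:R ^- 2) ->
  exists2 l : Cplx R, l != 0 & a @ \oo --> l.
Proof.
move=> a0 au u1 uC.
have an0 n : a n != 0 by elim: n => // n IH; rewrite au mulf_neq0.
have C0 : 0 <= C by have := le_trans (cnorm_ge0 _) (uC 0%N); rewrite expr1n invr1 mulr1.
(* Once n >= 2 C, the modulus of u n is at most 1/2, hence that of 1 + u n is at least 1/2. *)
have [n||n Nn|d d0 ud] := @lower_bound_pos R (fun n => cnorm (1 + u n))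
    (Num.bound (2 * C)) 2^-1.
- by rewrite cnorm_gt0.
- by rewrite invr_gt0.
- have CN : 2 * C <= n.+1%:R.
    apply: (le_trans (ltW (archi_boundP (mulr_ge0 (ler0n _ 2) C0)))).
    by rewrite ler_nat (leq_trans Nn).
  have u2 : cnorm (u n) <= 2^-1.
    rewrite (le_trans (uC n))// ler_pdivrMr ?exprn_gt0// [leRHS]mulrC ler_pdivlMr//.
    by rewrite mulrC (le_trans CN)// expr2 ler_peMr// ler1n.
  have := cnormD (1 + u n) (- u n).
  by rewrite addrK cnormN ComplexField.Normc.normc1; lra.
have [l al] := cvg_infinite_product au uC.
have [||l' al'] := @cvg_infinite_product (fun n => (a n)^-1)
    (fun n => - u n / (1 + u n)) (C / d).
- move=> n; rewrite au invfM; congr (_ * _).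
  by apply: (mulIf (u1 n)); rewrite mulVf// mulrDl divfK// mul1r addrK.
- move=> n; rewrite cnormM cnormN cnormV mulrAC ler_pM ?invr_ge0 ?cnorm_ge0//.
  by rewrite lef_pV2// posrE (lt_le_trans d0).
have ll' : l * l' = 1.
  have H : (fun n => a n * (a n)^-1) @ \oo --> l * l' by exact: cvgM.
  have E : (fun n => a n * (a n)^-1) = cst 1.
    by apply/funext => n; rewrite /= mulfV.
  rewrite E in H.
  by apply: (cvg_unique _ H (cvg_cst _)); exact: norm_hausdorff.
by exists l => //; apply: contra_eq_neq ll' => ->; rewrite mul0r eq_sym oner_eq0.
Qed.

End infinite_product.

(** * Convergence of Gauss's product *)

Section Gauss_product.
Context {R : realType}.
Implicit Types s : Cplx R.

Definition Gauss_product s n : Cplx R :=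
  n`!%:R * cpow n%:R s / \prod_(j < n.+1) (s + j%:R).

Lemma Re_addn_neq0 {s} n : 0 < complex.Re s -> s + n%:R != 0.
Proof.
case: s => a b /= a0; apply/eqP => /(congr1 (@complex.Re R)).
by rewrite -(rmorph_nat (real_complex R)) /= => /eqP; rewrite gt_eqF// ltr_pwDl.
Qed.

Lemma cpow_nat s n : (0 < n)%N -> cpow n%:R s = cexp (s * (ln n%:R)%:C%C).
Proof. by move=> n0; rewrite /cpow clog_nat. Qed.

(** Both bounds are ln (1 + t) <= t, at t = -1/(n + 2) and at t = 1/(n + 1). *)
Lemma ln_succ_diff n :
  n.+2%:R^-1 <= ln n.+2%:R - ln n.+1%:R :> R /\
  ln n.+2%:R - ln n.+1%:R <= n.+1%:R^-1 :> R.
Proof.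
have n1 : 0 < n.+1%:R :> R by rewrite ltr0Sn.
have n2 : 0 < n.+2%:R :> R by rewrite ltr0Sn.
split.
  rewrite -lerN2 opprB -ln_div ?posrE//.
  rewrite (_ : _ / _ = 1 + - n.+2%:R^-1); last first.
    by rewrite -[n.+1%:R](addrK 1) natr1 mulrBl divff ?gt_eqF// mul1r.
  by apply: le_ln1Dx; rewrite ltrN2 invf_lt1 ?ltr1n.
rewrite -ln_div ?posrE// (_ : _ / _ = 1 + n.+1%:R^-1); last first.
  by rewrite -[n.+2%:R]natr1 mulrDl divff ?gt_eqF// mul1r.
by apply: le_ln1Dx; rewrite (lt_le_trans (ltrN10 R))// invr_ge0.
Qed.

(** The indices start at 1, since at 0 the power has base 0, whose logarithm is only a default
    value. *)
Lemma Gauss_product_succ {s} n : 0 < complex.Re s ->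
  Gauss_product s n.+2 = Gauss_product s n.+1 *
    (n.+2%:R * cexp (s * (ln n.+2%:R - ln n.+1%:R)%:C%C) / (s + n.+2%:R)).
Proof.
move=> s0; rewrite /Gauss_product factS natrM !cpow_nat// big_ord_recr /=.
have -> : cexp (s * (ln n.+2%:R)%:C%C) = cexp (s * (ln n.+1%:R)%:C%C) *
    cexp (s * (ln n.+2%:R - ln n.+1%:R)%:C%C).
  by rewrite -cexpD -mulrDr -rmorphD addrC subrK.
by rewrite invfM; ring.
Qed.

Lemma Gauss_product_cvg {s} : 0 < complex.Re s ->
  exists2 l : Cplx R, l != 0 & Gauss_product s @ \oo --> l.
Proof.
move=> s0.
pose d n : R := ln n.+2%:R - ln n.+1%:R.
pose u n : Cplx R := n.+2%:R * cexp (s * (d n)%:C%C) / (s + n.+2%:R) - 1.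
have [M M0 taylor] := cexp_taylor1 (cnorm s).
(* In the constant, M |s|^2 comes from the Taylor remainder of the exponential and |s| from
   replacing N d n by 1, with N = n + 2. *)
have [||||l l0 gl] := @cvg_infinite_product_neq0 R
    (fun n => Gauss_product s n.+1) u (M * cnorm s ^+ 2 + cnorm s).
- rewrite /Gauss_product cpow_nat//; apply: mulf_neq0.
    by apply: mulf_neq0 (cexp_neq0 _); rewrite pnatr_eq0.
  by rewrite invr_eq0; apply/prodf_neq0 => j _; exact: Re_addn_neq0.
- by move=> n; rewrite Gauss_product_succ// /u [1 + _]addrC subrK.
- move=> n; rewrite /u [1 + _]addrC subrK; apply: mulf_neq0.
    by apply: mulf_neq0 (cexp_neq0 _); rewrite pnatr_eq0.
  by rewrite invr_eq0 Re_addn_neq0.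
- move=> n; have [dl du] := ln_succ_diff n; rewrite -/(d n) in dl du.
  pose N : R := n.+2%:R; pose q : R := n.+1%:R^-1.
  have N0 : 0 < N by rewrite ltr0Sn.
  have q0 : 0 < q by rewrite invr_gt0 ltr0Sn.
  have d0 : 0 <= d n by apply: le_trans dl; rewrite invr_ge0.
  have d1 : d n <= 1 by rewrite (le_trans du)// invf_le1 ?ltr0Sn// ler1n.
  have sd : cnorm (s * (d n)%:C%C) = cnorm s * d n.
    by rewrite cnormM cnorm_real ger0_norm.
  have sN0 := Re_addn_neq0 n.+2 s0.
  have NsN : N <= cnorm (s + n.+2%:R).
    apply: le_trans (cnorm_Re _); apply: le_trans (ler_norm _).
    by case: (s) s0 => a b; rewrite -(rmorph_nat (real_complex R)) /= => /ltW; rewrite lerDr.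
  (* Since 1 / N <= d n <= q, each of the two summands is O(q). *)
  have uE : u n * (s + n.+2%:R) = n.+2%:R * (cexp (s * (d n)%:C%C) - 1 - s * (d n)%:C%C)
      + s * (N * d n - 1)%:C%C.
    have -> (t : R) : (N * t - 1)%:C%C = n.+2%:R * t%:C%C - 1 :> Cplx R.
      by rewrite rmorphB rmorphM /= rmorph_nat.
    by rewrite /u mulrBl divfK//; ring.
  have T := taylor (s * (d n)%:C%C); rewrite sd in T.
  have {}T : cnorm (cexp (s * (d n)%:C%C) - 1 - s * (d n)%:C%C)
      <= M * cnorm s ^+ 2 * q ^+ 2.
    rewrite (le_trans (T _))// ?ler_piMr ?cnorm_ge0// exprMn mulrA.
    by rewrite ler_wpM2l ?(mulr_ge0 M0) ?sqr_ge0// ler_pXn2r ?nnegrE// ltW.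
  (* The upper bound uses N q = 1 + q. *)
  have Nd : `|N * d n - 1| <= q.
    rewrite ger0_norm; last by rewrite subr_ge0 -(@mulfV _ N) ?gt_eqF// ler_wpM2l// ltW.
    rewrite lerBlDr (le_trans (ler_wpM2l (ltW N0) du))//.
    by rewrite /N -natr1 mulrDl mulfV ?pnatr_eq0// mul1r addrC.
  have Nq : N^-1 <= q by rewrite lef_pV2 ?posrE ?ltr0Sn// ler_nat.
  have uN : cnorm (u n) * N <= N * (M * cnorm s ^+ 2 * q ^+ 2) + cnorm s * q.
    apply: (@le_trans _ _ (cnorm (u n) * cnorm (s + n.+2%:R))).
      by rewrite ler_wpM2l ?cnorm_ge0.
    rewrite -cnormM uE (le_trans (cnormD _ _))// lerD//.
      by rewrite cnormM cnorm_nat ler_wpM2l// ltW.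
    by rewrite cnormM cnorm_real ler_wpM2l ?cnorm_ge0.
  (* After multiplication by N, the second summand is absorbed through q <= q^2 N, as N q >= 1. *)
  rewrite -exprVn -/q -(ler_pM2r N0) (le_trans uN)//.
  rewrite (_ : _ * N = N * (M * cnorm s ^+ 2 * q ^+ 2) + cnorm s * (q ^+ 2 * N)).
    rewrite lerD2l ler_wpM2l ?cnorm_ge0// expr2 -mulrA ler_peMr ?(ltW q0)//.
    by rewrite -[leLHS](@mulVf _ N) ?gt_eqF// ler_wpM2r// ltW.
  by ring.
- by exists l => //; rewrite -cvg_shiftS.
Qed.

End Gauss_product.

(** * Nonvanishing and functional equation of Gamma *)

Section Gamma_theory.
Context {R : realType}.
Implicit Types s : Cplx R.

Lemma cvg_cnorm_le {f : nat -> Cplx R} {l : Cplx R} (C : R) :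
  (forall n, cnorm (l - f n) <= C * n.+1%:R^-1) -> f @ \oo --> l.
Proof.
move=> fl; apply/cvgrPdist_le => _ /Cplx_gt0P[e e0 ->].
have C0 : 0 <= C by have := le_trans (cnorm_ge0 _) (fl 0%N); rewrite invr1 mulr1.
near=> n; rewrite cnormE lecR (le_trans (fl n))//.
rewrite ler_pdivrMr ?ltr0Sn// mulrC -ler_pdivrMr//.
rewrite (le_trans (ltW (archi_boundP (divr_ge0 C0 (ltW e0)))))// ler_nat leqW//.
by near: n; exact: nbhs_infty_ge.
Unshelve. all: by end_near. Qed.

Lemma Gamma_cvg {s} : 0 < complex.Re s -> Gauss_product s @ \oo --> Gamma s.
Proof.
by move=> /Gauss_product_cvg[l _ sl]; rewrite (_ : Gamma s = l)//; exact: cvg_lim.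
Qed.

Lemma Gamma_neq0 {s} : 0 < complex.Re s -> Gamma s != 0.
Proof.
by move=> /Gauss_product_cvg[l l0 sl]; rewrite (_ : Gamma s = l)//; exact: cvg_lim.
Qed.

(** Gauss's products at s + 1 and s differ by the factor s r n, where r n tends to 1. *)
Lemma Gamma_succ {s} : 0 < complex.Re s -> Gamma (s + 1) = s * Gamma s.
Proof.
move=> s0.
have sn0 n : s + n%:R != 0 by exact: Re_addn_neq0.
have ss0 : s != 0 by have := sn0 0%N; rewrite addr0.
have s10 : 0 < complex.Re (s + 1) by case: (s) s0 => a b /= ?; rewrite addr_gt0.
pose r n : Cplx R := n.+1%:R / (s + n.+2%:R).
have E n : Gauss_product (s + 1) n.+1 = Gauss_product s n.+1 * s * r n.
  rewrite /Gauss_product !cpow_nat// mulrDl mul1r cexpD cexp_real.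
  rewrite lnK ?posrE ?ltr0Sn// rmorph_nat /r.
  have -> : \prod_(j < n.+2) (s + 1 + j%:R) =
      (\prod_(j < n.+2) (s + j%:R)) * (s + n.+2%:R) / s.
    rewrite -(big_ord_recr n.+2 (fun j => s + j%:R)) [in RHS]big_ord_recl /=.
    rewrite addr0 mulrAC divff// mul1r; apply: eq_bigr => j _.
    by rewrite /bump /= add1n -nat1r addrA.
  by rewrite !invfM invrK; ring.
have r1 : r @ \oo --> (1 : Cplx R).
  apply: (cvg_cnorm_le (cnorm (s + 1))) => n.
  rewrite (_ : 1 - r n = (s + 1) / (s + n.+2%:R)); last first.
    rewrite /r -[X in X - _](divff (sn0 n.+2)) -mulrBl; congr (_ / _).
    by rewrite -(natr1 n.+1); ring.
  rewrite cnormM cnormV ler_wpM2l ?cnorm_ge0// lef_pV2 ?posrE ?cnorm_gt0//.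
  apply: le_trans (cnorm_Re _); apply: le_trans (ler_norm _).
  case: (s) s0 => a b; rewrite -(rmorph_nat (real_complex R)) /= => /ltW a0.
  by rewrite (@le_trans _ _ n.+2%:R) ?ler_nat// lerDr.
have := Gamma_cvg s10; rewrite -cvg_shiftS => H1.
have : (fun n => Gauss_product s n.+1 * s * r n) @ \oo --> Gamma s * s * 1.
  apply: cvgM r1; apply: cvgM; last exact: cvg_cst.
  by have := Gamma_cvg s0; rewrite -cvg_shiftS.
rewrite mulr1 mulrC => H2; apply: (cvg_unique _ H1); first exact: norm_hausdorff.
by rewrite (_ : (fun n => _) = (fun n => Gauss_product s n.+1 * s * r n))//;
  apply/funext.
Qed.

Lemma Gamma_addn {s} n : 0 < complex.Re s ->
  Gamma (s + n%:R) = \prod_(j < n) (s + j%:R) * Gamma s.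
Proof.
move=> s0; elim: n => [|n IH]; first by rewrite big_ord0 mul1r addr0.
rewrite -natr1 addrA Gamma_succ; first by rewrite IH big_ord_recr /=; ring.
case: (s) s0 => a b; rewrite -(rmorph_nat (real_complex R)) /= => a0.
by rewrite ltr_pwDl.
Qed.

End Gamma_theory.

(** * The multiple series *)

(** The coordinates [u] embed the finite set [A] in a box, and distributivity factors the sum over
    the box into one-variable sums. *)
Lemma sum_prod_le {R : realDomainType} {T : choiceType} {q : nat}
    {u : T -> 'I_q -> nat} {h : 'I_q -> nat -> R} {M : R} :
  (forall t t', u t =1 u t' -> t = t') -> (forall j k, 0 <= h j k) ->
  (forall j n, \sum_(k < n) h j k <= M) ->
  forall A : {fset T}, \sum_(t <- A) \prod_(j < q) h j (u t j) <= M ^+ q.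
Proof.
move=> uI h0 hM A.
pose N := \max_(t <- A) \max_(j < q) u t j.
pose d t := [ffun j => inord (u t j) : 'I_N.+1].
have uN t j : t \in A -> (u t j <= N)%N.
  move=> tA; apply: (@leq_trans (\max_(j < q) u t j)); first exact: leq_bigmax.
  exact: (leq_bigmax_seq (F := fun t => \max_(j < q) u t j)).
have dE t j : t \in A -> d t j = u t j :> nat.
  by move=> tA; rewrite ffunE inordK// ltnS uN.
pose G (phi : {ffun 'I_q -> 'I_N.+1}) := \prod_(j < q) h j (phi j).
have G0 phi : 0 <= G phi by apply: prodr_ge0.
rewrite (_ : \sum_(t <- A) _ = \sum_(t <- A) G (d t)); last first.
  rewrite big_seq [RHS]big_seq; apply: eq_bigr => t tA.
  by apply: eq_bigr => j _; rewrite dE.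
have dI : {in A &, injective d}.
  move=> t t' tA tA' E; apply: uI => j.
  by rewrite -dE// E dE.
rewrite -(big_imfset _ imfset_key G dI) /=.
apply: (@le_trans _ _ (\sum_(phi <- [fset phi | phi in {: {ffun 'I_q -> 'I_N.+1}}]%fset) G phi)).
  apply: ler_sum_fset => //; apply/fsubsetP => phi _.
  by apply/imfsetP; exists phi.
rewrite big_imfset//= big_enum /= -(bigA_distr_bigA (fun j (k : 'I_N.+1) => h j k)).
rewrite -[in leRHS](card_ord q) -prodr_const ler_prod// => j _.
by rewrite sumr_ge0//=; exact: hM.
Qed.

(** * Decay of complex powers along a translate of the naturals *)

Section cpow_decay.
Context {R : realType}.
Implicit Types a b w : Cplx R.

Lemma abs_carg_le_pi a : a != 0 -> `|carg a| <= pi.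
Proof.
move=> a0; have n0 : 0 < cnorm a by rewrite cnorm_gt0.
have aI : -1 <= complex.Re a / cnorm a <= 1.
  by rewrite -ler_norml normrM normfV (gtr0_norm n0) ler_pdivrMr// mul1r cnorm_Re.
have := acos_ge0 aI; have := acos_lepi aI.
by rewrite /carg; case: ifP => _ ? ?; rewrite ?normrN ger0_norm.
Qed.

(** The modulus of a^(-w) is exp (Im w arg a - Re w ln |a|), and the argument is at most pi in
    absolute value. *)
Lemma cnorm_cpowV_le {a} w : a != 0 ->
  cnorm (cpow a w)^-1 <=
    expR (`|complex.Im w| * pi) * expR (- (complex.Re w * ln (cnorm a))).
Proof.
move=> a0; rewrite cnormV cnorm_cexp -expRN -expRD ler_expR /clog.
case: w => c d /=; rewrite opprB lerD2r (le_trans (ler_norm _))// normrM.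
by rewrite ler_wpM2l// abs_carg_le_pi.
Qed.

Lemma cnorm_addn_ge {b} : (forall n, b + n%:R != 0) ->
  exists2 d : R, 0 < d & forall n, d * n.+1%:R <= cnorm (b + n%:R).
Proof.
move=> b0.
(* For n >= 2 |b| + 1, |b + n| >= n - |b| >= (n + 1) / 2; the finitely many other quotients are
   positive. *)
have [n||n Nn|d d0 dn] := @lower_bound_pos R
    (fun n => cnorm (b + n%:R) / n.+1%:R) (Num.bound (2 * cnorm b + 1)) 2^-1.
- by rewrite divr_gt0 ?cnorm_gt0 ?ltr0Sn.
- by rewrite invr_gt0.
- rewrite ler_pdivlMr ?ltr0Sn//.
  have bn : 2 * cnorm b + 1 <= n%:R.
    have /archi_boundP/ltW/le_trans : 0 <= 2 * cnorm b + 1.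
      by rewrite addr_ge0 ?mulr_ge0 ?cnorm_ge0.
    by apply; rewrite ler_nat.
  have := cnormD (b + n%:R) (- b); rewrite addrAC subrr add0r cnormN cnorm_nat.
  by rewrite -(natr1 n); lra.
by exists d => // n; rewrite -ler_pdivlMr ?ltr0Sn.
Qed.

Lemma cpow_addn_decay {b w} : (forall n, b + n%:R != 0) -> 2 <= complex.Re w ->
  exists2 C : R, 0 <= C &
    forall n, cnorm (cpow (b + n%:R) w)^-1 <= C * n.+1%:R ^- 2.
Proof.
move=> b0 w2; have [d d0 dn] := cnorm_addn_ge b0.
have w0 : 0 <= complex.Re w by rewrite (le_trans _ w2).
exists (expR (`|complex.Im w| * pi) * expR (- (complex.Re w * ln d))).
  by rewrite mulr_ge0 ?expR_ge0.
move=> n; rewrite (le_trans (cnorm_cpowV_le w (b0 n)))// -mulrA.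
rewrite ler_wpM2l ?expR_ge0//.
have n0 : 0 < n.+1%:R :> R by rewrite ltr0Sn.
rewrite -[in leRHS](lnK (x := n.+1%:R ^- 2)) ?posrE ?invr_gt0 ?exprn_gt0//.
rewrite -expRD ler_expR lnV ?posrE ?exprn_gt0// lnXn// -opprD lerN2.
apply: (@le_trans _ _ (complex.Re w * ln (d * n.+1%:R))).
  rewrite lnM ?posrE// mulrDr lerD2l -[_ *+ 2]mulr_natl.
  by rewrite ler_wpM2r// ln_ge0// ler1n.
by rewrite ler_wpM2l// ler_ln ?posrE ?mulr_gt0// cnorm_gt0.
Qed.

End cpow_decay.

(** * Change of variables between chains and multiplicities *)

Section multiplicity_family.
Context {p : nat}.
Implicit Types tl : p.-tuple nat * nat.

(* The exponent of j + 1: a pair (m_1, ..., m_p), l is read as the tuple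
   (m_1, ..., m_p, l). *)
Definition entry tl (j : nat) : nat := nth 0%N (rcons tl.1 tl.2) j.

Definition total tl : nat := (\sum_(j < p.+1) entry tl j)%N.

Lemma entry_lt t l (j : 'I_p) : entry (t, l) j = tnth t j.
Proof. by rewrite /entry nth_rcons size_tuple ltn_ord (tnth_nth 0%N). Qed.

Lemma entry_last t l : entry (t, l) p = l.
Proof. by rewrite /entry nth_rcons size_tuple ltnn eqxx. Qed.

Lemma total_pair t l : total (t, l) = (\sum_(j < p) tnth t j + l)%N.
Proof.
rewrite /total big_ord_recr /= entry_last; congr (_ + _)%N.
by apply: eq_bigr => j _; rewrite entry_lt.
Qed.

Lemma entry_inj tl tl' : (forall j : 'I_p.+1, entry tl j = entry tl' j) -> tl = tl'.
Proof.
case: tl tl' => [t l] [t' l'] E; congr pair; last first.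
  by have := E ord_max; rewrite /= !entry_last.
apply: eq_from_tnth => j; have := E (widen_ord (leqnSn p) j).
by rewrite /= !entry_lt.
Qed.

Section chain_theory.
Context {m : nat}.
Implicit Types k : p.-tuple 'I_m.+1.

(** Indices are shifted: [increment k j] stands for m_(j+1) = k_(j+1) - k_j. *)
Definition increment k j : nat := (chain k j.+1 - chain k j)%N.

Definition increments k : p.-tuple nat * nat :=
  ([tuple increment k j | j < p], increment k p).

Lemma entry_increments k (j : 'I_p.+1) : entry (increments k) j = increment k j.
Proof.
case: (ltnP j p) => [jp|pj].
  by have /= -> := entry_lt (increments k).1 (increment k p) (Ordinal jp);
    rewrite tnth_mktuple.
have -> : j = p :> nat by apply/eqP; rewrite eqn_leq pj -ltnS ltn_ord.
by rewrite entry_last.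
Qed.

Lemma chainS k (j : 'I_p) : chain k j.+1 = tnth k j.
Proof.
rewrite /chain /= nth_rcons size_map size_tuple ltn_ord.
by rewrite (nth_map ord0) ?size_tuple// (tnth_nth ord0).
Qed.

Lemma chain_last k : chain k p.+1 = m.
Proof. by rewrite /chain /= nth_rcons size_map size_tuple ltnn eqxx. Qed.

(** The end inequalities 0 <= k_1 and k_p <= m come from the entries being ordinals below m + 1.
    Monotonicity keeps the truncated subtraction in [increment] exact. *)
Lemma chain_homo k j : sorted leq (map val k) -> (j <= p)%N ->
  (chain k j <= chain k j.+1)%N.
Proof.
move=> ks jp; have : path leq 0%N (rcons (map val k) m).
  rewrite rcons_path; apply/andP; split; first by case: (map _ _) ks.
  have /allP : all (leq^~ m) (0%N :: map val k).
    by apply/allP => i; rewrite inE => /predU1P[->//|/mapP[a _ ->]]; exact: leq_ord.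
  by apply; exact: mem_last.
by move=> /(pathP 0%N)/(_ j); rewrite size_rcons size_map size_tuple ltnS; apply.
Qed.

Lemma sum_increment {k i} : sorted leq (map val k) -> (i <= p.+1)%N ->
  (\sum_(j < i) increment k j)%N = chain k i.
Proof.
move=> ks; elim: i => [|i IH] ip; first by rewrite big_ord0.
by rewrite big_ord_recr /= IH 1?ltnW// subnKC// chain_homo.
Qed.

Lemma total_increments {k} : sorted leq (map val k) -> total (increments k) = m.
Proof.
move=> ks; rewrite -[RHS](chain_last k) -sum_increment//.
by apply: eq_bigr => j _; exact: entry_increments.
Qed.

(** A chain is recovered from its increments by partial sums. *)
Lemma increments_inj :
  {in [pred k : p.-tuple 'I_m.+1 | sorted leq (map val k)] &, injective increments}.
Proof.
move=> k k' ks ks' E; apply: eq_from_tnth => j; apply: val_inj.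
have jp : (j.+1 <= p.+1)%N by rewrite ltnS ltnW.
rewrite /= -!chainS -(sum_increment ks jp) -(sum_increment ks' jp).
apply: eq_bigr => i _.
have ip : (i < p.+1)%N by rewrite (leq_trans (ltn_ord i))// ltnS ltnW.
have /= <- := entry_increments k (Ordinal ip).
by have /= <- := entry_increments k' (Ordinal ip); rewrite E.
Qed.

Lemma increments_surj {tl} : total tl = m ->
  exists2 k : p.-tuple 'I_m.+1, sorted leq (map val k) & tl = increments k.
Proof.
move=> tm; pose c i := (\sum_(j < i) entry tl j)%N.
have cS i : c i.+1 = (c i + entry tl i)%N by rewrite /c big_ord_recr.
have c_homo i j : (i <= j)%N -> (c i <= c j)%N.
  move=> /subnK <-; elim: (j - i)%N => // n; rewrite addSn cS => /leq_trans; apply.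
  exact: leq_addr.
(* The inverse map takes partial sums; they are bounded by the total m, so [inord] does not alter
   them. *)
pose k := [tuple inord (c j.+1) : 'I_m.+1 | j < p].
have kE (j : 'I_p) : tnth k j = c j.+1 :> nat.
  by rewrite tnth_mktuple inordK// ltnS -tm c_homo// ltnS ltnW.
have chainE i : (i <= p.+1)%N -> chain k i = c i.
  case: i => [|i]; first by rewrite /c big_ord0.
  rewrite ltnS leq_eqVlt => /predU1P[->|ip]; first by rewrite chain_last -tm.
  by rewrite (chainS k (Ordinal ip)) kE.
exists k.
  apply/(sortedP 0%N) => i; rewrite size_map size_tuple => ip.
  rewrite !(nth_map ord0) ?size_tuple ?(ltnW ip)//.
  have /= <- := tnth_nth ord0 k (Ordinal ip).
  have /= <- := tnth_nth ord0 k (Ordinal (ltnW ip)).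
  by rewrite !kE c_homo.
apply: entry_inj => j; rewrite entry_increments /increment.
by rewrite !chainE// ?cS ?addKn// ltnW.
Qed.

End chain_theory.
End multiplicity_family.

(** * The common family and its two groupings *)

Section multiple_series.
Context {R : realType}.
Context (p : nat) (b w : Cplx R).
Implicit Types tl : p.-tuple nat * nat.

Definition multiple_term tl : Cplx R :=
  (\prod_(j < p.+1) j.+1%:R ^+ entry tl j * cpow (b + (total tl)%:R) w)^-1.

Context (b0 : forall n, b + n%:R != 0) (w2 : 2 <= complex.Re w).

Lemma multiple_term_bounded : exists M : R,
  forall A : {fset p.-tuple nat * nat}, \sum_(tl <- A) cnorm (multiple_term tl) <= M.
Proof.
have [C C0 decay] := cpow_addn_decay b0 w2.
(* Index 0 has base 1 and no geometric decay, so it takes the inverse square supplied by the power.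
   The other bases are at least 2. Every one-variable sum is at most 2, whence 2^(p+1). *)
pose h (j : 'I_p.+1) (k : nat) : R :=
  if j == ord0 then k.+1%:R ^- 2 else j.+1%:R ^- k.
have h0 j k : 0 <= h j k by rewrite /h; case: ifP => _; rewrite invr_ge0 exprn_ge0.
have geom n : \sum_(k < n) (2%:R ^- k : R) = 2 - 2 * 2 ^- n.
  elim: n => [|n IH]; first by rewrite big_ord0 expr0; lra.
  by rewrite big_ord_recr /= IH exprS invfM; lra.
have hM j n : \sum_(k < n) h j k <= 2.
  have [->|j0] := eqVneq j ord0; first by rewrite /h eqxx; exact: sum_inv_sqr_le.
  rewrite /h (negbTE j0).
  apply: (@le_trans _ _ (\sum_(k < n) 2%:R ^- k)).
    apply: ler_sum => k _; rewrite lef_pV2 ?posrE ?exprn_gt0 ?ltr0Sn//.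
    rewrite lerXn2r ?nnegrE// ler_nat ltnS lt0n.
    by apply: contra_neq j0 => j0; apply: val_inj.
  by rewrite geom gerBl mulr_ge0// invr_ge0 exprn_ge0.
exists (C * 2 ^+ p.+1) => A.
apply: (@le_trans _ _ (\sum_(tl <- A) C * \prod_(j < p.+1) h j (entry tl j))).
  apply: ler_sum => tl _; rewrite /multiple_term invfM cnormM cnormV cnorm_prod.
  under eq_bigr do rewrite cnormX cnorm_nat.
  have P0 : 0 <= (\prod_(j < p.+1) j.+1%:R ^+ entry tl j)^-1 :> R.
    by rewrite invr_ge0 prodr_ge0// => j _; rewrite exprn_ge0.
  rewrite (le_trans (ler_wpM2l P0 (decay _)))// mulrCA ler_wpM2l//.
  rewrite !big_ord_recl /= expr1n mul1r mulrC -prodfV ler_pM ?invr_ge0 ?exprn_ge0//.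
    by apply: prodr_ge0 => j _; rewrite invr_ge0 exprn_ge0.
  rewrite /h eqxx lef_pV2 ?posrE ?exprn_gt0 ?ltr0Sn// lerXn2r ?nnegrE// ler_nat.
  by rewrite ltnS /total big_ord_recl leq_addr.
rewrite -mulr_sumr ler_wpM2l//.
apply: (sum_prod_le _ h0 hM) => tl tl' E; apply: entry_inj => j; exact: E.
Qed.

(* Zinner and Lerch_term with the tuple length p decoupled from v, so that
   v = p.+2 can be substituted without transporting tuples along p = v - 2. *)
Definition Zinner_at (v m : nat) : Cplx R :=
  \sum_(k : p.-tuple 'I_m.+1 | sorted leq (map val k))
    (\prod_(1 <= j < v) j%:R ^+ (chain k j - chain k j.-1)
     * cpow (b + m%:R) w)^-1.

(** The fibre over m is finite: [increments] puts it in bijection with the sorted chains. *)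
Lemma has_sum_total m : has_sum
  (fun tl => if total tl == m then multiple_term tl else 0) (Zinner_at p.+2 m).
Proof.
pose P := [pred k : p.-tuple 'I_m.+1 | sorted leq (map val k)].
rewrite (_ : Zinner_at _ _ = \sum_(k | P k) 
    if total (increments k) == m then multiple_term (increments k) else 0).
  apply: has_sum_image; first exact: increments_inj.
  move=> tl /=; have [tm _|] := eqVneq (total tl) m; last by rewrite eqxx.
  by have [k ks ->] := increments_surj tm; exists k.
apply: eq_bigr => k ks; rewrite total_increments// eqxx /multiple_term.
rewrite total_increments// big_add1 /= big_mkord; congr (_ * _)^-1.
by apply: eq_bigr => j _; rewrite entry_increments.
Qed.

Definition Lerch_term_at (v : nat) (x : Cplx R) (t : p.-tuple nat) : Cplx R :=
  (\prod_(j < p) (j.+1)%:R ^+ tnth t j)^-1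
  * Lerch w (1 / (v%:R - 1)) ((\sum_(j < p) tnth t j)%N%:R + x - 1).

Lemma has_sum_Lerch x t : b = x - 1 -> has_sum
  (fun tl => if tl.1 == t then multiple_term tl else 0) (Lerch_term_at p.+2 x t).
Proof.
move=> bx; have [M MA] := multiple_term_bounded.
have [A|F FP] := @has_sum_abs R _
    (fun tl => if tl.1 == t then multiple_term tl else 0) M.
  apply: le_trans (MA A); apply: ler_sum => tl _; case: ifP => // _.
  by rewrite ComplexField.Normc.normc0 cnorm_ge0.
suff -> : Lerch_term_at p.+2 x t = F by [].
(* Regrouping by the last coordinate turns the sum over the fibre of t into a sum over l, each class
   having at most one nonzero term. *)
have Fl : has_sum (fun l => multiple_term (t, l)) F.
  apply: (has_sum_fibre (fun tl => tl.2) FP) => l.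
  pose f tl := if tl.2 == l then if tl.1 == t then multiple_term tl else 0 else 0.
  have := @has_sum_image _ _ _ 'I_1 xpredT (fun=> (t, l)) f.
  rewrite big_ord1 [f (t, l)]/f /= !eqxx; apply.
    by move=> i j _ _ _; rewrite !ord1.
  move=> [t' l']; rewrite /f /=; have [->|] := eqVneq l' l; last by rewrite eqxx.
  by have [->|] := eqVneq t' t; [exists ord0|rewrite eqxx].
pose c : Cplx R := \prod_(j < p) (j.+1)%:R ^+ tnth t j.
have c0 : c != 0.
  by apply/prodf_neq0 => j _; rewrite expf_neq0// pnatr_eq0.
have /has_sum_series cF := has_sumZ c Fl.
rewrite /Lerch_term_at /Lerch -/c.
rewrite (_ : (fun l => _) = (fun l => c *: multiple_term (t, l))).
  have -> : limn (series (fun l => c *: multiple_term (t, l))) = c * F.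
    exact: cvg_lim.
  by rewrite mulKf.
(* With v = p + 2 the Lerch argument is 1 / (p + 1), whose powers are the weight of the last entry
   l. *)
apply/funext => l; rewrite mul1r -(natr1 p.+1) addrK exprVn /multiple_term.
rewrite big_ord_recr /= entry_last total_pair bx natrD.
have -> : \prod_(j < p) (j.+1%:R ^+ entry (t, l) j : Cplx R) = c.
  by apply: eq_bigr => j _; rewrite entry_lt.
set S := (\sum_(j < p) _)%N.
have -> : l%:R + (S%:R + x - 1) = x - 1 + (S%:R + l%:R) by ring.
by rewrite -mulrA [in RHS]invfM [RHS](mulVKf c0) [RHS]invfM.
Qed.

Lemma multiple_series x : b = x - 1 ->
  exists2 L : Cplx R, has_sum (Lerch_term_at p.+2 x) L &
    series (Zinner_at p.+2) @ \oo --> L.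
Proof.
move=> bx; have [M /has_sum_abs[L SL]] := multiple_term_bounded.
exists L; first by apply: (has_sum_fibre (fun tl => tl.1) SL) => t; exact: has_sum_Lerch.
by apply: has_sum_series; apply: (has_sum_fibre total SL) => m; exact: has_sum_total.
Qed.

End multiple_series.

(** For v = 2 the only chain is the empty tuple and the product reduces to a power of 1, so the
    separate Hurwitz case fits the general formula. *)
Lemma Z_series {R : realType} {v : nat} (x s : Cplx R) (hv : (2 <= v)%N) :
  Z s x v = - (\prod_(j < v) (s + j%:R) / (v.-1)`!%:R)
    * limn (series (fun m : nat => Zinner v m (x - 1) (s + v%:R))).
Proof.
rewrite /Z; case: eqP => // {hv}->.
rewrite big_ord_recr big_ord1 /= addr0 divr1; congr (_ * _).
rewrite /Hurwitz /Lerch (_ : (fun l => _) =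
  (fun m => Zinner 2 m (x - 1) (s + 2%:R)))//; apply/funext => m.
rewrite /Zinner (big_pred1 [tuple]) => [|k]; last by rewrite (tuple0 k); apply/esym/eqP.
by rewrite big_nat1 /= !expr1n !mul1r [m%:R + _]addrC.
Qed.

Theorem theorem1 (R : realType) (v : nat) (x s : Cplx R)
    (hv : (2 <= v)%N) (hx : ~ nonpos_int (x - 1))
    (hs : v%:R < complex.Re s) :
  cvg (partial_sum (@Lerch_term R s x v) @ totally) /\
  Z s x v = - (Gamma (s + v%:R) / ((v.-1)`!%:R * Gamma s))
            * summability.sum (@Lerch_term R s x v).
Proof.
have s0 : 0 < complex.Re s by rewrite (le_lt_trans _ hs).
have b0 n : x - 1 + n%:R != 0.
  by apply/eqP => /eqP; rewrite addr_eq0 => /eqP xn; apply: hx; exists n.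
have w2 : 2 <= complex.Re (s + v%:R).
  case: (s) hs => c d; rewrite -(rmorph_nat (real_complex R)) /= => /ltW cv.
  by rewrite (@le_trans _ _ v%:R) ?ler_nat// lerDr (le_trans _ cv).
have [L LL ZL] : exists2 L : Cplx R, has_sum (@Lerch_term R s x v) L &
    series (fun m => Zinner v m (x - 1) (s + v%:R)) @ \oo --> L.
  (* With p = v - 2, (v - 2) + 2 = v is rewritten only in the decoupled argument, leaving the tuple
     types untouched. *)
  have [L] := @multiple_series R (v - 2) _ _ b0 w2 x erefl.
  have -> : (v - 2).+2 = v by rewrite -addn2 subnK.
  by move=> LL ZL; exists L.
have -> : summability.sum (@Lerch_term R s x v) = L.
  exact: cvg_lim.
split; first exact: cvgP LL.
rewrite (Z_series x s hv) (_ : limn _ = L); last exact: cvg_lim.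
(* The rising factorial is the Gamma quotient, as Gamma s is nonzero. *)
congr (- _ * _); rewrite Gamma_addn//.
by rewrite invfM mulrACA divff ?Gamma_neq0// mulr1.
Qed.
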